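(* There exists no randomized algorithm for the $3$-MPMD problem on $D$-metrics against an oblivious adversary that has a competitive ratio which is bounded by a function of the number of points $n$.
   Context: The $k$-MPMD problem: a finite generalized metric space $(V,d)$ with $|V|=n$ and $d:V^k\to[0,\infty)$ is given. Requests arrive online; each request $\rho$ has a location $\ell(\rho)\in V$ and an arrival time $t(\rho)\ge 0$. The algorithm must irrevocably partition the request sequence $R$ (of size a multiple of $k$) into sets of exactly $k$ requests; a set can be formed at any time after all its members have arrived. Matching $\{\rho_1,\dots,\rho_k\}$ incurs space cost $d(\ell(\rho_1),\dots,\ell(\rho_k))$, and a request $\rho$ matched at time $t'(\rho)$ incurs time cost $t'(\rho)-t(\rho)$. The total cost is the sum of space and time costs; $\mathrm{cost}_{\mathcal{OPT}}(R)$ is the optimal offline cost. The competitive ratio of a randomized algorithm $\mathcal{ALG}$ is $\sup_R \mathbb{E}[\mathrm{cost}_{\mathcal{ALG}}(R)]/\mathrm{cost}_{\mathcal{OPT}}(R)$, with $R$ chosen by an oblivious adversary. A $D$-metric on $V$ is a function $d:V^3\to[0,\infty)$ such that for all $v_1,v_2,v_3,a\in V$: ($\Pi$) $d$ is invariant under permutations of its arguments; ($O_D$) $d(v_1,v_2,v_3)=0$ if and only if $v_1=v_2=v_3$, and $d(v_1,v_2,v_3)>0$ otherwise; ($\Delta_D$) $d(v_1,v_2,v_3)\le d(v_1,v_2,a)+d(v_1,a,v_3)+d(a,v_2,v_3)$. *)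

(* Defs.v *)
From HB Require Import structures.
From mathcomp Require Import all_boot all_order all_algebra.
From mathcomp Require Import all_classical all_reals all_analysis.

Set Implicit Arguments.
Unset Strict Implicit.
Unset Printing Implicit Defensive.

Import Order.TTheory GRing.Theory Num.Theory.
Local Open Scope classical_set_scope.
Local Open Scope ring_scope.

Record D_metric (R : realType) (V : finType) (d : 3.-tuple V -> R) : Prop := {
  D_metric_ge0 : forall v, 0 <= d v;
  D_metric_perm : forall v w : 3.-tuple V, perm_eq v w -> d v = d w;
  D_metric_eq0 : forall v1 v2 v3,
    d [tuple v1; v2; v3] = 0 <-> v1 = v2 /\ v2 = v3;
  D_metric_gt0 : forall v1 v2 v3,
    ~ (v1 = v2 /\ v2 = v3) -> 0 < d [tuple v1; v2; v3];
  D_metric_triangle : forall v1 v2 v3 a,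
    d [tuple v1; v2; v3]
      <= d [tuple v1; v2; a] + d [tuple v1; a; v3] + d [tuple a; v2; v3] }.

(* A request is a pair (location, arrival time); within a request sequence it
   is identified by its position. *)
Definition request (R : realType) (V : finType) : Type := (V * R)%type.

Definition location (R : realType) (V : finType) (r : seq (request R V))
  (i : 'I_(size r)) : V := (tnth (in_tuple r) i).1.

Definition arrival (R : realType) (V : finType) (r : seq (request R V))
  (i : 'I_(size r)) : R := (tnth (in_tuple r) i).2.

Definition request_sequence (R : realType) (V : finType) (k : nat)
    (r : seq (request R V)) : Prop :=
  [/\ sorted <=%R [seq q.2 | q <- r],
      all (fun q => 0 <= q.2) r
    & (k %| size r)%N].

(* A solution lists the groups it forms, each with its time of formation. The
   order of the members of a group is immaterial, d being symmetric. *)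
Definition solution (R : realType) (V : finType) (k : nat)
  (r : seq (request R V)) : Type := seq (k.-tuple 'I_(size r) * R)%type.

Definition feasible (R : realType) (V : finType) (k : nat)
    (r : seq (request R V)) (s : solution k r) : Prop :=
  perm_eq (flatten [seq tval g.1 | g <- s]) (enum 'I_(size r)) /\
  forall g, g \in s -> forall i, i \in g.1 -> arrival i <= g.2.

Definition cost (R : realType) (V : finType) (k : nat) (d : k.-tuple V -> R)
    (r : seq (request R V)) (s : solution k r) : R :=
  \sum_(g <- s) (d (map_tuple (@location R V r) g.1)
                 + \sum_(i <- g.1) (g.2 - arrival i)).

Definition opt_cost (R : realType) (V : finType) (k : nat)
    (d : k.-tuple V -> R) (r : seq (request R V)) : R :=
  inf [set cost d s | s in [set s : solution k r | feasible s]].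

Definition requests_until (R : realType) (V : finType) (t : R)
  (r : seq (request R V)) : seq (request R V) := [seq q <- r | q.2 <= t].

(* Positions are erased to natural numbers so that the solutions of different
   request sequences can be compared. *)
Definition groups_until (R : realType) (V : finType) (k : nat) (t : R)
    (r : seq (request R V)) (s : solution k r) : seq (seq nat * R) :=
  [seq ([seq val i | i <- tval g.1], g.2) | g <- s & g.2 <= t].

Definition strategy (R : realType) (V : finType) (k : nat) : Type :=
  forall r : seq (request R V), solution k r.

(* Deterministic online algorithms: the groups formed up to any time t are
   determined by the requests that have arrived up to time t. In particular
   they are irrevocable, and the length of the sequence is not known. *)
Definition online (R : realType) (V : finType) (k : nat)
    (A : strategy R V k) : Prop :=
  (forall r, request_sequence k r -> feasible (A r)) /\
  (forall r r' t, request_sequence k r -> request_sequence k r' ->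
    requests_until t r = requests_until t r' ->
    perm_eq (groups_until t (A r)) (groups_until t (A r'))).

(* A randomized algorithm is a random deterministic online algorithm. *)
Record randomized_algorithm (R : realType) (V : finType) (k : nat)
    (d : k.-tuple V -> R) := RandomizedAlgorithm {
  ra_display : measure_display;
  ra_space : measurableType ra_display;
  ra_prob : probability ra_space R;
  ra_strategy : ra_space -> strategy R V k;
  ra_online : forall w, online (ra_strategy w);
  ra_measurable : forall r, request_sequence k r ->
    measurable_fun setT (fun w => cost d (ra_strategy w r)) }.

Definition expected_cost (R : realType) (V : finType) (k : nat)
    (d : k.-tuple V -> R) (A : randomized_algorithm d)
    (r : seq (request R V)) : \bar R :=
  'E_(ra_prob A)[fun w => cost d (@ra_strategy R V k d A w r)].

(* The request sequence is fixed before the randomness is drawn: the adversary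
   is oblivious. Sequences of optimal cost 0, for which the quotient is
   meaningless, are left out. *)
Definition competitive_ratio (R : realType) (V : finType) (k : nat)
    (d : k.-tuple V -> R) (A : randomized_algorithm d) : \bar R :=
  ereal_sup [set (expected_cost A r / (opt_cost d r)%:E)%E |
             r in [set r | request_sequence k r /\ 0 < opt_cost d r]].

(* Main.v *)
Require Import Defs.
From mathcomp Require Import all_boot all_order all_algebra.
From mathcomp Require Import all_classical all_reals all_analysis.
From mathcomp Require Import measurable_realfun lra.

(** Two points [a], [b] suffice: [d(a,a,b) = 1] and [d(a,b,b) = M] is a
    D-metric for every [M > 0].  Three requests arrive at [a] at time 0.  An
    algorithm still holding them at time [t] has paid [t], whereas the optimum
    is 1 if [a,a,b] arrive later.  An algorithm that has matched them by time
    [t] pays [M] if [a,b,b] arrive at time [t + 1], whereas the optimum forms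
    [a,a,b] twice at cost [3 t + 5].  Up to time [t] the two inputs look the
    same, so each deterministic algorithm is bad on one of them; averaging over
    the randomness and taking first [t], then [M] large contradicts any bound on
    the ratio. *)

Set Implicit Arguments.
Unset Strict Implicit.
Unset Printing Implicit Defensive.

Import Order.TTheory GRing.Theory Num.Theory.
Local Open Scope ring_scope.

(** * Feasible solutions and lower bounds on their cost *)

Section Feasible.
Variables (R : realType) (V : finType) (k : nat) (d : k.-tuple V -> R).
Variables (r : seq (request R V)) (s : solution k r).
Hypothesis s_feasible : feasible s.

Lemma feasible_cover (i : 'I_(size r)) : exists2 g, g \in s & i \in g.1.
Proof.
have [/perm_mem/(_ i) + _] := s_feasible.
rewrite mem_enum => /flattenP[_ /mapP[g gs ->] ig].
by exists g.
Qed.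

Lemma feasible_uniq_flatten : uniq (flatten [seq tval g.1 | g <- s]).
Proof. by rewrite (perm_uniq s_feasible.1) enum_uniq. Qed.

Lemma feasible_uniq_group g : g \in s -> uniq g.1.
Proof.
move=> gs; have := feasible_uniq_flatten.
have /(perm_map (fun g => tval g.1))/perm_flatten/perm_uniq -> := perm_to_rem gs.
by rewrite /= cat_uniq => /andP[].
Qed.

(** No position repeats in the concatenated groups, so once [g] is deleted from [s] the remaining
    groups avoid its members. *)
Lemma feasible_group_inj g h i :
  g \in s -> h \in s -> i \in g.1 -> i \in h.1 -> g = h.
Proof.
move=> gs hs ig ih; apply/eqP/negPn/negP => gh.
have := feasible_uniq_flatten.
have sE := perm_to_rem gs.
have /(perm_map (fun g => tval g.1))/perm_flatten/perm_uniq -> := sE.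
rewrite /= cat_uniq => /and3P[_ /hasPn ng _].
have hr : h \in rem g s.
  by move: hs; rewrite (perm_mem sE) inE eq_sym (negPf gh).
suff /ng : i \in flatten [seq tval g.1 | g <- rem g s] by rewrite /= ig.
by apply/flattenP; exists (tval h.1) => //; apply: (map_f (fun g => tval g.1)).
Qed.

Hypothesis d_ge0 : forall v, 0 <= d v.

Lemma waiting_ge0 g : g \in s -> 0 <= \sum_(i <- g.1) (g.2 - arrival i).
Proof.
move=> gs; rewrite big_seq; apply: sumr_ge0 => i ig.
by rewrite subr_ge0 s_feasible.2.
Qed.

Lemma group_cost_le g : g \in s ->
  d (map_tuple (@location R V r) g.1) + \sum_(i <- g.1) (g.2 - arrival i)
  <= cost d s.
Proof.
move=> gs; rewrite /cost (big_rem _ gs) lerDl big_seq.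
by apply: sumr_ge0 => h /mem_rem hs; rewrite addr_ge0 ?waiting_ge0.
Qed.

Lemma cost_ge0 : 0 <= cost d s.
Proof.
by rewrite /cost big_seq; apply: sumr_ge0 => g gs; rewrite addr_ge0 ?waiting_ge0.
Qed.

Lemma space_cost_le g : g \in s ->
  d (map_tuple (@location R V r) g.1) <= cost d s.
Proof.
by move=> gs; apply: le_trans (group_cost_le gs); rewrite lerDl waiting_ge0.
Qed.

Lemma wait_le_cost g i : g \in s -> i \in g.1 -> g.2 - arrival i <= cost d s.
Proof.
move=> gs ig; apply: le_trans (group_cost_le gs).
rewrite (big_rem _ ig)/= addrCA lerDl addr_ge0// big_seq.
by apply: sumr_ge0 => j /mem_rem jg; rewrite subr_ge0 s_feasible.2.
Qed.

End Feasible.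

(** * Bounds on the optimum, and a criterion for feasibility *)

Lemma opt_cost_le (R : realType) (V : finType) (k : nat) (d : k.-tuple V -> R)
    (r : seq (request R V)) (s : solution k r) :
  (forall v, 0 <= d v) -> feasible s -> opt_cost d r <= cost d s.
Proof.
move=> d0 sf; apply: ge_inf; last by exists s.
by exists 0 => _ [s' s'f <-]; apply: cost_ge0.
Qed.

(** The witness [s] makes the set of costs nonempty; the infimum of the empty set is 0 by
    convention. *)
Lemma le_opt_cost (R : realType) (V : finType) (k : nat) (d : k.-tuple V -> R)
    (r : seq (request R V)) (s : solution k r) (c : R) :
  feasible s -> (forall s' : solution k r, feasible s' -> c <= cost d s') ->
  c <= opt_cost d r.
Proof.
move=> sf cle; apply: lb_le_inf; first by exists (cost d s), s.
by move=> _ [s' s'f <-]; apply: cle.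
Qed.

(** On natural numbers the partition condition for an explicit solution becomes a computation. *)
Lemma feasible_val (R : realType) (V : finType) (k : nat)
    (r : seq (request R V)) (s : solution k r) :
  perm_eq (flatten [seq [seq val i | i <- tval g.1] | g <- s])
          (iota 0 (size r)) ->
  (forall g, g \in s -> all (fun i => arrival i <= g.2) g.1) ->
  feasible s.
Proof.
move=> ps late; split; last by move=> g /late/allP.
apply: (perm_map_inj val_inj).
by rewrite map_flatten -map_comp val_enum_ord.
Qed.

(** * The two-point space and the two competing inputs *)

Section TwoPoints.
Variables (R : realType) (M : R).
Hypothesis M_ge1 : 1 <= M.

(* [false] is the point [a] and [true] the point [b]. *)
Definition two_point (v : 3.-tuple bool) : R :=
  nth 0 [:: 0; 1; M; 0] (count id v).

Lemma two_point_ge0 v : 0 <= two_point v.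
Proof.
have M0 : 0 <= M by apply: le_trans M_ge1.
by rewrite /two_point; case: (count id v) => [|[|[|[|n]]]] //=; rewrite nth_nil.
Qed.

(** If both points occur in a triple, the auxiliary point equals one of its entries, so the left
    side of the triangle inequality reappears as a summand on the right, however large [M] is. *)
Lemma two_point_D_metric : D_metric two_point.
Proof.
have M1 := M_ge1; split.
- exact: two_point_ge0.
- by move=> v w /permP vw; rewrite /two_point vw.
- rewrite /two_point => -[] [] [] /=; split=> //; move=> H;
    first [exfalso; lra | by case: H].
- by rewrite /two_point => -[] [] [] /= H; try lra; case: H.
- by rewrite /two_point => -[] [] [] [] /=; lra.
Qed.

(** This keeps both optima positive, as [competitive_ratio] demands: a group with a request at [b]
    contains one or two such requests. *)
Lemma two_point_cost_ge1 (r : seq (request R bool)) (s : solution 3 r) :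
  feasible s -> (0 < count fst r < 3)%N -> 1 <= cost two_point s.
Proof.
move=> sf /andP[]; rewrite -has_count => /hasP[q qr qb] r3.
have [i qi] : exists i, q = tnth (in_tuple r) i by apply/tnthP.
have [g gs ig] := feasible_cover sf i.
apply: le_trans (space_cost_le sf two_point_ge0 gs).
have c0 : (0 < count id (map_tuple (@location R bool r) g.1))%N.
  rewrite -has_count; apply/hasP; exists (location i); first exact: map_f.
  by rewrite /= /location -qi.
(* Members of a group are distinct requests, so at most as many of them lie at [b] as in all of
   [r]. *)
have c3 : (count id (map_tuple (@location R bool r) g.1) < 3)%N.
  apply: leq_ltn_trans r3; rewrite /= count_map -size_filter.
  rewrite -[X in (_ <= count _ X)%N](map_tnth_enum (in_tuple r)) count_map.
  rewrite -[X in (_ <= X)%N]size_filter; apply: uniq_leq_size.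
    by rewrite filter_uniq// (feasible_uniq_group sf).
  by move=> j; rewrite mem_filter => /andP[jb _]; rewrite mem_filter mem_enum andbT.
move: c0 c3; rewrite /two_point.
by case: (count id _) => [|[|[|n]]].
Qed.

Variables (t : R).
Hypothesis t_ge0 : 0 <= t.

Definition bait : seq (request R bool) :=
  [:: (false, 0); (false, 0); (false, 0)].

Definition reward : seq (request R bool) :=
  bait ++ [:: (false, t + 1); (false, t + 1); (true, t + 1)].

Definition trap : seq (request R bool) :=
  bait ++ [:: (false, t + 1); (true, t + 1); (true, t + 1)].

Lemma reward_sequence : request_sequence 3 reward.
Proof. by split=> //=; rewrite ?lexx ?addr_ge0. Qed.

Lemma trap_sequence : request_sequence 3 trap.
Proof. by split=> //=; rewrite ?lexx ?addr_ge0. Qed.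

Lemma requests_until_bait : requests_until t reward = requests_until t trap.
Proof.
have nt : (t + 1 <= t) = false by apply/negbTE; rewrite -ltNge; lra.
by rewrite /requests_until /= t_ge0 nt.
Qed.

Definition reward_solution : solution 3 reward :=
  [:: ([tuple (inord 0 : 'I_6); inord 1; inord 2], 0);
      ([tuple (inord 3 : 'I_6); inord 4; inord 5], t + 1)].

Definition trap_solution : solution 3 trap :=
  [:: ([tuple (inord 0 : 'I_6); inord 1; inord 4], t + 1);
      ([tuple (inord 2 : 'I_6); inord 3; inord 5], t + 1)].

Lemma reward_feasible : feasible reward_solution.
Proof.
apply: feasible_val; first by rewrite /= !inordK.
move=> g; rewrite !inE => /orP[] /eqP-> /=;
  by rewrite /arrival !(tnth_nth (false, 0)) /= !inordK //= ?lexx ?addr_ge0.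
Qed.

Lemma trap_feasible : feasible trap_solution.
Proof.
apply: feasible_val; first by rewrite /= !inordK.
move=> g; rewrite !inE => /orP[] /eqP-> /=;
  by rewrite /arrival !(tnth_nth (false, 0)) /= !inordK //= ?lexx ?addr_ge0.
Qed.

Lemma opt_reward_le : opt_cost two_point reward <= 1.
Proof.
apply: le_trans (opt_cost_le two_point_ge0 reward_feasible) _.
rewrite /cost !big_cons !big_nil /two_point /= /location /arrival.
by rewrite !(tnth_nth (false, 0)) /= !inordK //=; lra.
Qed.

(** Both groups are of type [a,a,b] and have space cost 1; each of the three early requests waits
    [t + 1]. *)
Lemma opt_trap_le : opt_cost two_point trap <= 3 * t + 5.
Proof.
apply: le_trans (opt_cost_le two_point_ge0 trap_feasible) _.
rewrite /cost !big_cons !big_nil /two_point /= /location /arrival.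
by rewrite !(tnth_nth (false, 0)) /= !inordK //=; lra.
Qed.

Lemma opt_reward_gt0 : 0 < opt_cost two_point reward.
Proof.
apply: lt_le_trans (ltr01) _; apply: le_opt_cost reward_feasible _ => s sf.
exact: two_point_cost_ge1.
Qed.

Lemma opt_trap_gt0 : 0 < opt_cost two_point trap.
Proof.
apply: lt_le_trans (ltr01) _; apply: le_opt_cost trap_feasible _ => s sf.
exact: two_point_cost_ge1.
Qed.

(** Already the request at position 0, which arrives at time 0, waits longer than [t]. *)
Lemma reward_unmatched (s : solution 3 reward) :
  feasible s -> groups_until t s = [::] -> t <= cost two_point s.
Proof.
move=> sf s0; have [g gs ig] := feasible_cover sf (inord 0 : 'I_6).
apply: le_trans (wait_le_cost sf two_point_ge0 gs ig).
rewrite /arrival (tnth_nth (false, 0)) inordK //= subr0 leNgt.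
apply/negP => /ltW gt.
have : g \in [seq g <- s | g.2 <= t] by rewrite mem_filter gt.
by move: s0; rewrite /groups_until; case: (seq.filter _ s).
Qed.

(* A group formed by time [t] consists of the three early requests, so the
   other group is [a,b,b]. *)
Lemma trap_matched (s : solution 3 trap) :
  feasible s -> groups_until t s <> [::] -> M <= cost two_point s.
Proof.
have t0 := t_ge0; move=> sf; rewrite /groups_until.
case E : [seq g <- s | g.2 <= t] => [//|g l] _.
have : g \in [seq g <- s | g.2 <= t] by rewrite E mem_head.
rewrite mem_filter => /andP[gt gs].
(* Positions 3 to 5 arrive at [t + 1], too late for [g]. *)
have g3 i : i \in g.1 -> (val i < 3)%N.
  move=> ig; have := le_trans (sf.2 _ gs _ ig) gt.
  rewrite /arrival (tnth_nth (false, 0)).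
  case: i {ig} => -[|[|[|[|[|[|n]]]]]] //= _; lra.
have uval h : h \in s -> uniq (map val h.1).
  by move=> hs; rewrite (map_inj_uniq val_inj) (feasible_uniq_group sf hs).
have gE : map val g.1 =i iota 0 3.
  apply: (uniq_min_size (uval _ gs) _ _).2.
    by move=> _ /mapP[i /g3 i3 ->]; rewrite mem_iota.
  by rewrite size_map size_iota size_tuple.
(* The group of position 5 differs from [g], hence is disjoint from it and consists of positions 3,
   4, 5. *)
have [h hs h5] := feasible_cover sf (inord 5 : 'I_6).
have h3 i : i \in h.1 -> (3 <= val i)%N.
  move=> ih; rewrite leqNgt; apply/negP => i3.
  have : val i \in map val g.1 by rewrite gE mem_iota.
  rewrite (mem_map val_inj) => ig.
  have gh := feasible_group_inj sf gs hs ig ih.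
  by move: h5; rewrite -gh => /g3; rewrite /= inordK.
have hE : perm_eq (map val h.1) (iota 3 3).
  apply: uniq_perm => //; first exact: uval.
  apply: (uniq_min_size (uval _ hs) _ _).2.
    by move=> _ /mapP[i /h3 i3 ->]; rewrite mem_iota i3 ltn_ord.
  by rewrite size_map size_iota size_tuple.
apply: le_trans (space_cost_le sf two_point_ge0 hs).
have -> : two_point (map_tuple (@location R bool trap) h.1) = M; last by [].
rewrite /two_point /=.
have -> : map (@location R bool trap) h.1 =
    map (fun n => (nth (false, 0) trap n).1) (map val h.1).
  by rewrite -map_comp; apply: eq_map => i; rewrite /= /location (tnth_nth (false, 0)).
by have /permP -> := perm_map (fun n => (nth (false, 0) trap n).1) hE.
Qed.

(** The cases are whether a group exists by time [t] on [reward]; being online carries the answer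
    over to [trap]. *)
Lemma online_dichotomy (A : strategy R bool 3) : online A ->
  t <= cost two_point (A reward) \/ M <= cost two_point (A trap).
Proof.
move=> [Af Ao].
have := Ao _ _ _ reward_sequence trap_sequence requests_until_bait.
case: (groups_until t (A reward) =P [::]) => [r0 _|r0 rt].
  by left; apply: reward_unmatched r0; exact: (Af _ reward_sequence).
right; apply: trap_matched; first exact: (Af _ trap_sequence).
by move=> t0; move: rt; rewrite t0 => /perm_nilP.
Qed.

End TwoPoints.

(** * From the competitive ratio to expected costs *)

Lemma expected_cost_le (R : realType) (V : finType) (k : nat)
    (d : k.-tuple V -> R) (A : randomized_algorithm d)
    (r : seq (request R V)) (F o : R) :
  (competitive_ratio A <= F%:E)%E -> 0 <= F -> request_sequence k r ->
  0 < opt_cost d r <= o -> (expected_cost A r <= (F * o)%:E)%E.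
Proof.
move=> AF F0 rr /andP[r0 ro].
have : (expected_cost A r / (opt_cost d r)%:E <= F%:E)%E.
  by apply: le_trans AF; apply: ereal_sup_ubound; exists r.
(* As the optimum is nonzero, its extended inverse is the real one. *)
rewrite inver gt_eqF// lee_pdivrMr// -EFinM => /le_trans; apply.
by rewrite lee_fin ler_wpM2l.
Qed.

Section ExpectedCost.
Local Open Scope ereal_scope.

(* Markov-type averaging: it needs no measurability of the event that the early
   requests are matched by time [t]. *)
Lemma expected_dichotomy (R : realType) (V : finType) (k : nat)
    (d : k.-tuple V -> R) (A : randomized_algorithm d)
    (r1 r2 : seq (request R V)) (a b : R) :
  (forall v, (0 <= d v)%R) ->
  request_sequence k r1 -> request_sequence k r2 -> (0 < a)%R -> (0 < b)%R ->
  (forall B : strategy R V k, online B ->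
    (a <= cost d (B r1))%R \/ (b <= cost d (B r2))%R) ->
  1 <= a^-1%:E * expected_cost A r1 + b^-1%:E * expected_cost A r2.
Proof.
move=> d0 rs1 rs2 a0 b0 ab; rewrite /expected_cost unlock.
have c0 r : request_sequence k r ->
    forall w, (0 <= cost d (@ra_strategy R V k d A w r))%R.
  by move=> rs w; apply: cost_ge0 => //; exact: (ra_online w).1.
have mc r : request_sequence k r ->
    measurable_fun setT (fun w => (cost d (@ra_strategy R V k d A w r))%:E).
  by move=> rs; apply/measurable_EFinP; apply: ra_measurable.
have ia0 : (0 <= a^-1)%R by rewrite invr_ge0 ltW.
have ib0 : (0 <= b^-1)%R by rewrite invr_ge0 ltW.
rewrite -!ge0_integralZl//; last first.
- by move=> w _; rewrite lee_fin c0.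
- exact: mc.
- by move=> w _; rewrite lee_fin c0.
- exact: mc.
rewrite -ge0_integralD//; last first.
- by apply: measurable_funeM; exact: mc.
- by move=> w _; rewrite mule_ge0 ?lee_fin ?c0.
- by apply: measurable_funeM; exact: mc.
- by move=> w _; rewrite mule_ge0 ?lee_fin ?c0.
(* The constant 1 becomes its own integral, which leaves a pointwise comparison. *)
rewrite -[leLHS](@probability_setT _ _ _ (ra_prob A)) -[leLHS]mul1e -integral_cst//.
apply: ge0_le_integral => //.
- by apply: emeasurable_funD; apply: measurable_funeM; exact: mc.
- move=> w _; rewrite /= -!EFinM -EFinD lee_fin.
  have [h|h] := ab _ (ra_online w).
  + by rewrite ler_wpDr// ?mulr_ge0 ?c0// ler_pdivlMl// mulr1.
  + by rewrite ler_wpDl// ?mulr_ge0 ?c0// ler_pdivlMl// mulr1.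
Qed.

End ExpectedCost.

Theorem theorem2 (R : realType) :
  ~ exists (f : nat -> R)
      (ALG : forall (V : finType) (d : 3.-tuple V -> R),
               D_metric d -> randomized_algorithm d),
      forall (V : finType) (d : 3.-tuple V -> R) (dD : D_metric d),
        (competitive_ratio (ALG V d dD) <= (f #|V|)%:E)%E.
Proof.
move=> [f [ALG bound]].
(* The value of [f] at two points is fixed before [M], hence before the metric, is chosen. It may be
   small or negative, whence the maximum with 1. *)
pose F := Num.max 1 (f #|{: bool}|).
have F1 : 1 <= F by rewrite le_max lexx.
have fF : f #|{: bool}| <= F by rewrite le_max lexx orbT.
(* These choices make each of the two terms of the averaged bound equal to 1/4, so that 1 would be
   at most 1/2. *)
pose t := 4 * F; pose M := 4 * F * (3 * t + 5).
have t0 : 0 < t by rewrite /t; lra.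
have t0' := ltW t0.
have M1 : 1 <= M by rewrite /M /t; nra.
have M0 : 0 < M by lra.
pose A := ALG _ _ (two_point_D_metric M1).
have AF : (competitive_ratio A <= F%:E)%E.
  by apply: le_trans (bound _ _ _) _; rewrite lee_fin.
have F0 : 0 <= F by lra.
have := expected_dichotomy A (two_point_ge0 M1) (reward_sequence t0')
  (trap_sequence t0') t0 M0 (online_dichotomy M1 t0').
have Er := expected_cost_le AF F0 (reward_sequence t0')
  (introT andP (conj (opt_reward_gt0 M1 t) (opt_reward_le M1 t))).
have Et := expected_cost_le AF F0 (trap_sequence t0')
  (introT andP (conj (opt_trap_gt0 M1 t0') (opt_trap_le M1 t0'))).
apply/negP; rewrite -ltNge.
apply: (@le_lt_trans _ _ (t^-1 * (F * 1) + M^-1 * (F * (3 * t + 5)))%:E).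
  by rewrite EFinD; apply: leeD; rewrite EFinM lee_wpmul2l// lee_fin invr_ge0 ltW.
have Fn : F != 0 by rewrite gt_eqF//; lra.
have cn : 3 * t + 5 != 0 by rewrite gt_eqF//; lra.
rewrite lte_fin.
have -> : t^-1 * (F * 1) = 4^-1 by rewrite /t mulr1 invfM mulfVK.
have -> : M^-1 * (F * (3 * t + 5)) = 4^-1.
  by rewrite /M -mulrA invfM mulfVK// mulf_neq0.
lra.
Qed.
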